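(* Let $n,d\in\mathbb{N}$, $\lambda\ge1$ and $\beta\in(0,1]$. If $\mathsf{M}\colon\mathbb{R}^+\times(\mathbb{R}^d)^n\to\mathbb{R}^d$ is a $(\lambda,\beta)$-estimator for averaging and $\mathsf{M}(\gamma,\cdot)$ is $\left(1,\frac{\beta}{4n}\right)$-differentially private for every $\gamma\ge0$, then $$n\geq\Omega\!\left(\frac{\sqrt d/\lambda}{\log^{1.5}\!\left(\frac{d}{\beta\lambda}\right)}\right).$$
   Context: A mechanism $\mathsf{M}$ on datasets $(x_1,\dots,x_n)$ is $(\varepsilon,\delta)$-differentially private if for every two datasets differing in exactly one element and every set $T$ of outputs, $\Pr[\mathsf{M}(X)\in T]\le e^{\varepsilon}\Pr[\mathsf{M}(X')\in T]+\delta$. A mechanism $\mathsf{M}\colon\mathbb{R}^+\times(\mathbb{R}^d)^n\to\mathbb{R}^d$ is a $(\lambda,\beta)$-estimator for averaging if for every $\gamma\ge0$ and every $x_1,\dots,x_n\in\{-1,1\}^d$ with $\max_{i,j\in[n]}\|x_i-x_j\|_2\le\gamma$, it holds that $\Pr\left[\left\|\mathsf{M}(\gamma,x_1,\dots,x_n)-\frac1n\sum_{i=1}^n x_i\right\|_2\le\lambda\gamma\right]\ge\beta$. The $\Omega(\cdot)$ hides a positive absolute constant.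
   Formalization: The logarithm is read as max(1, ln(d/(βλ))), since log^{1.5} is undefined for d < βλ and the bound blows up falsely as d/(βλ) tends to 1; and n ≥ 1 is assumed, since β/(4n) and the average are undefined for n = 0. *)

(* Defs.v *)
From HB Require Import structures.
From mathcomp Require Import all_boot all_order all_algebra.
From mathcomp Require Import all_classical all_reals all_analysis.
From mathcomp Require Import Rstruct Rstruct_topology.
From Stdlib Require Import Rdefinitions.

Set Implicit Arguments.
Unset Strict Implicit.
Unset Printing Implicit Defensive.

Import Order.TTheory GRing.Theory Num.Theory.
Local Open Scope classical_set_scope.
Local Open Scope ring_scope.

Notation vec d := ('rV[R]_d) (only parsing).

Definition l2norm (d : nat) (v : vec d) : R := Num.sqrt (\sum_(j < d) v ord0 j ^+ 2).

Definition borelRd (d : nat) := g_sigma_algebraType (@open (vec d)).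

Definition dataset (n d : nat) := 'I_n -> vec d.

(* A (randomized) mechanism on datasets: each dataset is mapped to the output
   distribution, a probability measure on the Borel sets of R^d. *)
Definition mechanism (n d : nat) := dataset n d -> probability (borelRd d) R.

Definition neighbors (n d : nat) (X X' : dataset n d) : Prop :=
  exists i : 'I_n, X i <> X' i /\ forall j : 'I_n, j <> i -> X j = X' j.

Definition diff_private (n d : nat) (eps delta : R) (M : mechanism n d) : Prop :=
  forall X X' : dataset n d, neighbors X X' ->
  forall T : set (borelRd d), measurable T ->
    (M X T <= (expR eps)%:E * M X' T + delta%:E)%E.

Definition average (n d : nat) (X : dataset n d) : vec d :=
  (n%:R)^-1 *: \sum_(i < n) X i.

Definition in_hypercube (n d : nat) (X : dataset n d) : Prop :=
  forall (i : 'I_n) (j : 'I_d), X i ord0 j = 1 \/ X i ord0 j = -1.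

Definition averaging_estimator (n d : nat) (lambda beta : R)
    (M : R -> mechanism n d) : Prop :=
  forall (gamma : R) (X : dataset n d), 0 <= gamma -> in_hypercube X ->
    (forall i j : 'I_n, l2norm (X i - X j) <= gamma) ->
    (beta%:E <= M gamma X [set y : borelRd d | (l2norm ((y : vec d) - average X) <= lambda * gamma)%R])%E.

(* Main.v *)
(** Draw the [d] columns of a bit matrix i.i.d.: a column [c] (the set of users whose bit
    is [1]) is constant with probability close to [1], and otherwise [#|c| = k] has
    probability proportional to [n / (k (n - k))].  Few columns are mixed, so all users are
    close to each other and an accurate estimate determines, up to rounding, almost all of
    the constant columns.

    User [i] is traced by correlating the rounded output with a column score that has mean
    zero when the bit of [i] is resampled given the other users' bits.  For this column
    distribution the scores of all users cancel on mixed columns and add up to [+- r / p] on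
    constant ones, so accuracy deterministically forces some user to have a large score.
    Privacy allows replacing the traced row by a resampled one, and then an exponential
    moment bound shows that a large score is too unlikely unless [n] is large. *)

From Stdlib Require Import Rdefinitions.
Require Import Defs.
From mathcomp Require Import all_boot all_order all_algebra.
From mathcomp Require Import all_classical all_reals all_analysis.
From mathcomp Require Import Rstruct Rstruct_topology.
From mathcomp Require Import ring lra zify.
Import Order.TTheory GRing.Theory Num.Theory.
Local Open Scope ring_scope.

Set Implicit Arguments.
Unset Strict Implicit.
Unset Printing Implicit Defensive.

(** * Elementary bounds on exponentials and harmonic sums *)

(** Inverting [1 - u <= expR (- u)] gives [expR u <= (1 - u)^-1], and [(1 + u + 2 u^2)(1 - u) = 1 +
    u^2 (1 - 2 u) >= 1]. *)
Lemma expR_le_quadratic {R : realType} (u : R) :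
  u <= 2^-1 -> expR u <= 1 + u + 2 * u ^+ 2.
Proof.
move=> u1; have lt1 : 0 < 1 - u by lra.
apply: (@le_trans _ _ (1 - u)^-1).
  rewrite -[expR u]invrK lef_pV2 ?posrE ?invr_gt0 ?expR_gt0 // -expRN.
  exact: expR_ge1Dx.
rewrite -[leLHS]mul1r ler_pdivrMr //.
have -> : (1 + u + 2 * u ^+ 2) * (1 - u) = 1 + u ^+ 2 * (1 - 2 * u) by ring.
by rewrite lerDl mulr_ge0 ?sqr_ge0 //; lra.
Qed.

(** Each new term is at most [ln (n + 1) - ln n], by [ln (1 + x) <= x] at [x = - 1 / (n + 1)]; the
    empty sum uses [ln 0 = 0]. *)
Lemma harmonic_le_ln {R : realType} n :
  \sum_(1 <= k < n.+1) k%:R^-1 <= 1 + ln n%:R :> R.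
Proof.
elim: n => [|n IH]; first by rewrite big_geq // ln0 // addr0.
rewrite big_nat_recr //=.
have [->|n0] := eqVneq n 0%N; first by rewrite big_geq // ln1; lra.
apply: (@le_trans _ _ (1 + ln n%:R + n.+1%:R^-1)); first by rewrite lerD2r.
rewrite -addrA lerD2l -lerBrDr.
have nR : 0 < n%:R :> R by rewrite ltr0n lt0n.
have -> : n%:R = (n.+1%:R : R) * (1 - n.+1%:R^-1).
  by rewrite mulrBr mulr1 mulfV // -natr1; ring.
rewrite lnM ?posrE ?ltr0Sn //; last first.
  by rewrite subr_gt0 invf_lt1 ?ltr0Sn // ltr1n ltnS lt0n.
by rewrite lerD2l le_ln1Dx // ltrN2 invf_lt1 ?ltr0Sn // ltr1n ltnS lt0n.
Qed.

(** Normalising sum over the sizes of a mixed column; by partial fractions it is twice a harmonic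
    sum, hence logarithmic in [n]. *)
Definition mixed_mass (R : realType) n : R :=
  \sum_(1 <= k < n) n%:R / (k%:R * (n - k)%:R).

Lemma mixed_mass_le {R : realType} n : (0 < n)%N -> mixed_mass R n <= 2 * (1 + ln n%:R).
Proof.
move=> n_gt0; rewrite /mixed_mass big_nat.
rewrite (eq_bigr (fun k => k%:R^-1 + (n - k)%:R^-1)); last first.
  move=> k /andP[k0 kn].
  have -> : n%:R = k%:R + (n - k)%:R :> R by rewrite -natrD subnKC // ltnW.
  have : 0 < k%:R :> R by rewrite ltr0n.
  have : 0 < (n - k)%:R :> R by rewrite ltr0n subn_gt0.
  by move: (n - k)%:R k%:R => a b a0 b0; field; rewrite !gt_eqF.
rewrite -big_nat big_split /= [X in _ + X]big_nat_rev /=.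
have -> : \sum_(1 <= k < n) (n - (1 + n - k.+1))%:R^-1 = \sum_(1 <= k < n) k%:R^-1 :> R.
  by apply: eq_big_nat => k /andP[k0 kn]; congr (_%:R^-1); lia.
have : \sum_(1 <= k < n) k%:R^-1 <= 1 + ln n%:R :> R.
  apply: le_trans (harmonic_le_ln n); rewrite big_nat_recr //= lerDl.
  by rewrite invr_ge0.
lra.
Qed.

Lemma mixed_mass_ge0 {R : realType} n : 0 <= mixed_mass R n.
Proof. by apply: sumr_ge0 => k _; rewrite divr_ge0 ?mulr_ge0. Qed.

(** * Distribution and score of a single column *)

Section Columns.
Context {R : realType} {n : nat}.
Context (r p : R).
Context (n_gt0 : (0 < n)%N) (r_gt0 : 0 < r) (p_gt0 : 0 < p) (r_le_p : r <= p).
Implicit Types (i : 'I_n) (c : {set 'I_n}).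

Definition mixed c := (0 < #|c| < n)%N.

(** A mixed size [k] has mass [r n / (k (n - k))], shared equally by its ['C(n, k)] sets; each of
    the two constant columns has mass [p]. *)
Definition col_weight c : R :=
  if mixed c then r * n%:R / (#|c|%:R * (n - #|c|)%:R * 'C(n, #|c|)%:R) else p.

(** Weight times score; prescribing this product first turns the mean-zero requirement into an
    identity between two binomials. *)
Definition col_signal i c : R :=
  if i \in c then r / (#|c|%:R * 'C(n, #|c|)%:R)
  else - (r / ((n - #|c|)%:R * 'C(n, #|c|)%:R)).

Definition col_score i c : R := col_signal i c / col_weight c.

Lemma card_col_le c : (#|c| <= n)%N.
Proof. by have := max_card (mem c); rewrite card_ord. Qed.

Lemma mixedPn c : ~~ mixed c = (c == finset.set0) || (c == finset.setT).
Proof.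
rewrite /mixed negb_and -!leqNgt leqn0 finset.cards_eq0; congr (_ || _).
by rewrite finset.eqEcard finset.subsetT finset.cardsT card_ord.
Qed.

Lemma bin_card_gt0 c : 0 < 'C(n, #|c|)%:R :> R.
Proof. by rewrite ltr0n bin_gt0 card_col_le. Qed.

Lemma col_weight_gt0 c : 0 < col_weight c.
Proof.
rewrite /col_weight; case: ifP => // /andP[k0 kn].
by rewrite divr_gt0 ?mulr_gt0 ?bin_card_gt0 ?ltr0n ?subn_gt0.
Qed.

Lemma col_weight_score i c : col_weight c * col_score i c = col_signal i c.
Proof. by rewrite mulrC divfK // gt_eqF ?col_weight_gt0. Qed.

Lemma notin_card_lt i c : i \notin c -> (#|c| < n)%N.
Proof.
by move=> ic; have := card_col_le (i |: c); rewrite finset.cardsU1 ic.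
Qed.

Lemma in_card_gt0 i c : i \in c -> (0 < #|c|)%N.
Proof. by move=> ic; rewrite (finset.cardsD1 i) ic. Qed.

(** The two denominators agree: [(m + 1) 'C(n, m + 1) = (n - m) 'C(n, m)] with [m = #|c :\ i|]. *)
Lemma col_signal_cancel i c :
  col_signal i (i |: c) + col_signal i (c :\ i) = 0.
Proof.
rewrite /col_signal finset.setU11 finset.setD11.
have -> : #|i |: c| = #|c :\ i|.+1.
  by rewrite (finset.cardsD1 i) finset.setU11 finset.setDUl finset.setDv finset.set0U.
set m := #|c :\ i|.
by rewrite -!natrM mul_bin_left subrr.
Qed.

(** The factor [n / (k (n - k))] in the weight is chosen to make the score the centred bit of [i],
    whose sum over users vanishes. *)
Lemma col_score_mixed i c : mixed c ->
  col_score i c = (i \in c)%:R - #|c|%:R / n%:R.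
Proof.
move=> mc; rewrite /col_score /col_signal /col_weight mc.
move/andP: mc => [k0 kn]; have := bin_card_gt0 c.
have [k0R kR] : 0 < #|c|%:R :> R /\ 0 < (n - #|c|)%:R :> R.
  by rewrite !ltr0n subn_gt0.
have nE : n%:R = #|c|%:R + (n - #|c|)%:R :> R by rewrite -natrD subnKC // ltnW.
rewrite nE; move: #|c|%:R (n - #|c|)%:R 'C(n, #|c|)%:R k0R kR => a b e a0 b0 e0.
by case: (i \in c) => /=; field; rewrite !gt_eqF //= addr_gt0.
Qed.

Lemma col_signal_pad i c : ~~ mixed c ->
  col_signal i c = (if i \in c then r else - r) / n%:R.
Proof.
rewrite /mixed /col_signal; case: ifP => ic.
  rewrite (in_card_gt0 ic) /= -leqNgt => nk.
  have -> : #|c| = n by apply/eqP; rewrite eqn_leq card_col_le.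
  by rewrite binn mulr1.
rewrite (@notin_card_lt i) ?ic // andbT -leqNgt leqn0 => /eqP->.
by rewrite subn0 bin0 mulr1 mulNr.
Qed.

Lemma col_score_pad i c : ~~ mixed c ->
  col_score i c = (if i \in c then r else - r) / (n%:R * p).
Proof.
move=> mc; rewrite /col_score col_signal_pad // /col_weight (negbTE mc).
by rewrite invfM mulrA.
Qed.

Lemma norm_col_score_pad i c : ~~ mixed c ->
  `|col_score i c| = r / (n%:R * p).
Proof.
move=> mc; rewrite col_score_pad // normrM [X in _ * X]gtr0_norm; last first.
  by rewrite invr_gt0 mulr_gt0 // ltr0n.
by case: ifP => _; rewrite ?normrN gtr0_norm.
Qed.

Lemma norm_col_score_le1 i c : `|col_score i c| <= 1.
Proof.
have n1 : 1 <= n%:R :> R by rewrite ler1n.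
have [mc|mc] := boolP (mixed c); last first.
  rewrite norm_col_score_pad // ler_pdivrMr ?mulr_gt0 ?ltr0n // mul1r.
  by rewrite (le_trans r_le_p) // ler_peMl // ltW.
rewrite col_score_mixed //.
have : 0 <= (#|c|%:R / n%:R : R) <= 1.
  rewrite divr_ge0 //= ler_pdivrMr ?ltr0n // mul1r ler_nat.
  exact: card_col_le.
by move=> /andP[a0 a1]; rewrite ler_norml; case: (i \in c) => /=; lra.
Qed.

Lemma sum_col_score c : \sum_i col_score i c =
  if mixed c then 0 else if c == finset.set0 then - (r / p) else r / p.
Proof.
have n0 : n%:R != 0 :> R by rewrite pnatr_eq0 -lt0n.
case: ifPn => mc.
  under eq_bigr do rewrite col_score_mixed //.
  have sumI : \sum_(i < n) (i \in c)%:R = #|c|%:R :> R.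
    rewrite -sum1_card natr_sum [RHS]big_mkcond /=.
    by apply: eq_bigr => i _; case: (i \in c).
  rewrite big_split /= sumrN sumI sumr_const card_ord.
  by rewrite -[_ *+ n]mulr_natr divfK // subrr.
under eq_bigr do rewrite col_score_pad //.
rewrite -mulr_suml; case: ifPn => [/eqP->|c0].
  rewrite (eq_bigr (fun=> - r)); last by move=> i _; rewrite finset.in_set0.
  rewrite sumr_const card_ord -mulr_natr; field.
  by rewrite n0 gt_eqF.
move: (mc); rewrite mixedPn (negbTE c0) /= => /eqP->.
rewrite (eq_bigr (fun=> r)); last by move=> i _; rewrite finset.in_setT.
by rewrite sumr_const card_ord -mulr_natr; field; rewrite n0 gt_eqF.
Qed.

(** * Moments of the score when one bit is resampled *)

Definition agree i c c' := c' :\ i == c :\ i.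

Lemma agree_sum i c (F : {set 'I_n} -> R) :
  \sum_(c' | agree i c c') F c' = F (i |: c) + F (c :\ i).
Proof.
have ne : c :\ i != i |: c.
  apply/eqP => /(congr1 (fun a : {set 'I_n} => i \in a)).
  by rewrite finset.setU11 finset.setD11.
rewrite (bigD1 (i |: c)) /=; last by rewrite /agree finset.setDUl finset.setDv finset.set0U.
rewrite (bigD1 (c :\ i)) /=; last by rewrite /agree finset.setDDl finset.setUid eqxx.
rewrite big1 ?addr0 // => c' /andP[/andP[/eqP ac c1] c0].
have [ic|ic] := boolP (i \in c').
  case/eqP: c1; rewrite -(finset.setD1K ic) ac; apply/setP => j; rewrite !inE.
  by case: (j == i).
case/eqP: c0; rewrite -ac; apply/setP => j; rewrite !inE.
by have [->|//] := eqVneq j i; rewrite (negbTE ic).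
Qed.

(* The other users' bits already disagree, whatever the bit of user [i]. *)
Definition mixed_off i c := mixed (i |: c) && mixed (c :\ i).

Lemma mixed_off_agree i c c' : agree i c c' -> mixed_off i c' = mixed_off i c.
Proof.
move=> /eqP ac; have UD a : i |: a = i |: (a :\ i).
  by apply/setP => j; rewrite !inE; case: (j == i).
by rewrite /mixed_off ac (UD c') ac -UD.
Qed.

Lemma mixed_offW i c : mixed_off i c -> mixed c.
Proof.
rewrite /mixed_off; have [ic|ic] := boolP (i \in c).
  suff -> : i |: c = c by case/andP.
  by apply/finset.setUidPr; rewrite finset.sub1set.
suff -> : c :\ i = c by case/andP.
by apply/setP => j; rewrite !inE; have [->|//] := eqVneq j i; rewrite (negbTE ic).
Qed.

Definition score_var i c : R := if mixed_off i c then 1 else r / (n%:R * p).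

Lemma agree_score_mean i c :
  \sum_(c' | agree i c c') col_weight c' * col_score i c' = 0.
Proof.
under eq_bigr do rewrite col_weight_score.
by rewrite agree_sum col_signal_cancel.
Qed.

(** A mean-zero variable on two points [s0], [s1] has variance [- s1 s0]. Scores are at most [1] in
    absolute value, and outside [mixed_off] one completion is constant, with score of size
    [r / (n p)]. *)
Lemma agree_score_var i c :
  \sum_(c' | agree i c c') col_weight c' * col_score i c' ^+ 2 <=
  score_var i c * \sum_(c' | agree i c c') col_weight c'.
Proof.
have := agree_score_mean i c; rewrite !agree_sum.
have := col_weight_gt0 (i |: c); have := col_weight_gt0 (c :\ i).
have : `|col_score i (i |: c)| * `|col_score i (c :\ i)| <= score_var i c.
  have [s1 s0] := (norm_col_score_le1 i (i |: c), norm_col_score_le1 i (c :\ i)).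
  rewrite /score_var; case: ifPn => [_|]; first by rewrite mulr_ile1.
  rewrite negb_and => /orP[] mc; rewrite -(norm_col_score_pad i mc).
    by rewrite ler_piMr.
  by rewrite ler_piMl.
set s1 := col_score i (i |: c); set s0 := col_score i (c :\ i).
set w1 := col_weight (i |: c); set w0 := col_weight (c :\ i).
rewrite -normrM -normrN => /(le_trans (ler_norm _)) var_ge w0_gt0 w1_gt0 mean0.
have -> : w1 * s1 ^+ 2 + w0 * s0 ^+ 2 = - (s1 * s0) * (w1 + w0).
  apply/eqP; rewrite -subr_eq0.
  have -> : w1 * s1 ^+ 2 + w0 * s0 ^+ 2 - - (s1 * s0) * (w1 + w0) =
            (s1 + s0) * (w1 * s1 + w0 * s0) by ring.
  by rewrite mean0 mulr0.
by rewrite ler_wpM2r // addr_ge0 // ltW.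
Qed.

(** The exponents are at most [1/2], so [expR_le_quadratic] applies; the linear term has mean zero
    and [agree_score_var] bounds the quadratic one. *)
Lemma agree_score_mgf i c (s theta : R) : s ^+ 2 = 1 -> 0 <= theta <= 2^-1 ->
  \sum_(c' | agree i c c') col_weight c' * expR (theta * (s * col_score i c')) <=
  expR (2 * theta ^+ 2 * score_var i c) * \sum_(c' | agree i c c') col_weight c'.
Proof.
move=> s1 /andP[t0 t1].
have s_norm : `|s| = 1.
  by apply/eqP; rewrite -(@eqrXn2 _ 2) // -normrX s1 normr1 expr1n.
have score_le x : col_weight x * expR (theta * (s * col_score i x)) <=
    col_weight x + theta * s * (col_weight x * col_score i x)
    + 2 * theta ^+ 2 * (col_weight x * col_score i x ^+ 2).
  have -> : col_weight x + theta * s * (col_weight x * col_score i x)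
    + 2 * theta ^+ 2 * (col_weight x * col_score i x ^+ 2) =
    col_weight x * (1 + theta * (s * col_score i x)
      + 2 * (theta * (s * col_score i x)) ^+ 2).
    have -> : (theta * (s * col_score i x)) ^+ 2 =
       theta ^+ 2 * col_score i x ^+ 2 by rewrite !exprMn s1 mul1r.
    by ring.
  rewrite ler_wpM2l ?(ltW (col_weight_gt0 x)) // expR_le_quadratic //.
  apply: le_trans (ler_norm _) _; rewrite normrM (normrM s) s_norm mul1r (ger0_norm t0).
  by apply: le_trans t1; rewrite ler_piMr // norm_col_score_le1.
apply: le_trans (ler_sum _ (fun x _ => score_le x)) _.
rewrite !big_split /= -!mulr_sumr agree_score_mean mulr0 addr0.
set u := \sum_(c' | _) col_weight c'.
have u0 : 0 <= u by apply: sumr_ge0 => x _; rewrite ltW ?col_weight_gt0.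
apply: (@le_trans _ _ ((1 + 2 * theta ^+ 2 * score_var i c) * u)); last first.
  by rewrite ler_wpM2r // expR_ge1Dx.
rewrite [leRHS]mulrDl mul1r lerD2l -[leRHS]mulrA ler_wpM2l ?agree_score_var //.
by rewrite mulr_ge0 ?sqr_ge0.
Qed.

(** * Total mass of the column distribution *)

Lemma sum_mixed_weight : \sum_(c | mixed c) col_weight c = r * mixed_mass R n.
Proof.
(* Group by size: the number ['C(n, k)] of sets cancels the binomial in the weight. *)
rewrite (partition_big (fun c => inord #|c| : 'I_n.+1)
  (fun k : 'I_n.+1 => 0 < k < n)%N) /=; last first.
  by move=> c mc; rewrite inordK // ltnS card_col_le.
rewrite (eq_bigr (fun k : 'I_n.+1 => r * (n%:R / (k%:R * (n - k)%:R)))); last first.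
  move=> k /andP[k0 kn].
  rewrite (eq_bigl (fun c => #|c| == k)); last first.
    move=> c; rewrite -val_eqE /= inordK ?ltnS ?card_col_le //.
    by rewrite andbC /mixed; have [->|//] := eqVneq #|c| (val k); rewrite k0 kn.
  rewrite (eq_bigr (fun=> r * n%:R / (k%:R * (n - k)%:R * 'C(n, k)%:R))); last first.
    by move=> c /eqP ck; rewrite /col_weight /mixed ck k0 kn.
  rewrite sumr_const -cardsE card_draws card_ord -[LHS]mulr_natr.
  have : 0 < 'C(n, k)%:R :> R by rewrite ltr0n bin_gt0 ltnW.
  have : 0 < k%:R :> R by rewrite ltr0n.
  have : 0 < (n - k)%:R :> R by rewrite ltr0n subn_gt0.
  move: 'C(n, k)%:R (n - k)%:R k%:R => a b e a0 b0 e0.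
  by field; rewrite !gt_eqF.
rewrite -(big_mkord (fun k => (0 < k < n)%N) (fun k => r * (n%:R / (k%:R * (n - k)%:R)))).
rewrite -mulr_sumr; congr (_ * _); rewrite /mixed_mass.
by rewrite (big_nat_widenl 1 0) // (big_nat_widen 0 n n.+1).
Qed.

Lemma sum_col_weight : 2 * p + r * mixed_mass R n = 1 -> \sum_c col_weight c = 1.
Proof.
move=> <-; rewrite (bigID mixed) /= sum_mixed_weight addrC; congr (_ + _).
rewrite (eq_bigr (fun=> p)); last by move=> c /negbTE mc; rewrite /col_weight mc.
rewrite sumr_const.
(* The empty and the full column are distinct because [n > 0]. *)
have -> : #|[pred c : {set 'I_n} | ~~ mixed c]| = 2.
  have <- : #|finset.set1 (finset.set0 : {set 'I_n}) :|: finset.set1 finset.setT| = 2.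
    rewrite finset.cards2; case: eqVneq => // /(congr1 (fun a : {set 'I_n} => #|a|)).
    by rewrite finset.cards0 finset.cardsT card_ord; lia.
  apply: eq_card => c; rewrite !inE -mixedPn //.
by rewrite mulr_natl.
Qed.

(** * Bit matrices with independent columns *)

Section Matrices.
Context {d : nat}.
Local Notation mat := {ffun 'I_d -> {set 'I_n}}.
Local Notation signs := {ffun 'I_d -> bool}.
Implicit Types (X : mat) (s : signs).

Definition mat_weight X : R := \prod_j col_weight (X j).

(** Equality off row [i], phrased column by column as a [family] so that sums over a class
    factor. *)
Definition mat_agree i X X' := X' \in family (fun j => agree i (X j)).

Definition class_weight i X : R := \sum_(X' | mat_agree i X X') mat_weight X'.

Definition mixed_count X : R := \sum_j (mixed (X j))%:R.

(** Independent of row [i], unlike [mixed_count], so a bound on it survives resampling that row. *)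
Definition mixed_off_count i X : R := \sum_j (mixed_off i (X j))%:R.

Definition pm1 (b : bool) : R := if b then 1 else -1.

Definition trace_score s i X : R := \sum_j pm1 (s j) * col_score i (X j).

Lemma mat_agreeP i X X' :
  reflect (forall j, X' j :\ i = X j :\ i) (mat_agree i X X').
Proof.
apply: (iffP familyP) => [H j|H j]; last exact/eqP.
exact/eqP/H.
Qed.

Lemma mat_agree_refl i X : mat_agree i X X.
Proof. exact/mat_agreeP. Qed.

Lemma mat_agree_sym i X X' : mat_agree i X X' = mat_agree i X' X.
Proof. by apply/mat_agreeP/mat_agreeP => H j; rewrite H. Qed.

Lemma mat_agree_eq i X X' : mat_agree i X X' -> mat_agree i X =1 mat_agree i X'.
Proof.
move=> /mat_agreeP H X''; apply/mat_agreeP/mat_agreeP => H' j; by rewrite H' H.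
Qed.

Lemma class_weight_agree i X X' :
  mat_agree i X X' -> class_weight i X = class_weight i X'.
Proof. by move=> H; apply: eq_bigl; exact: mat_agree_eq. Qed.

Lemma mixed_off_count_agree i X X' :
  mat_agree i X X' -> mixed_off_count i X = mixed_off_count i X'.
Proof.
move=> /mat_agreeP H; apply: eq_bigr => j _.
by rewrite (@mixed_off_agree i (X j) (X' j)) // /agree H.
Qed.

Lemma mixed_off_count_le i X : mixed_off_count i X <= mixed_count X.
Proof.
apply: ler_sum => j _; rewrite ler_nat.
by case: (boolP (mixed_off i (X j))) => // /mixed_offW ->.
Qed.

Lemma mat_weight_gt0 X : 0 < mat_weight X.
Proof. by apply: prodr_gt0 => j _; exact: col_weight_gt0. Qed.

Lemma class_weight_gt0 i X : 0 < class_weight i X.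
Proof.
rewrite /class_weight (bigD1 X) ?mat_agree_refl //= ltr_pwDl ?mat_weight_gt0 //.
by apply: sumr_ge0 => X' _; rewrite ltW ?mat_weight_gt0.
Qed.

Lemma class_weight_prod i X :
  class_weight i X = \prod_j \sum_(c | agree i (X j) c) col_weight c.
Proof. by rewrite bigA_distr_big_dep. Qed.

Lemma pm1_sqr b : pm1 b ^+ 2 = 1.
Proof. by case: b; rewrite /= ?expr1n // sqrrN expr1n. Qed.

(** Chernoff bound for a fixed output [s]: given the other rows the columns are independent, and
    their variance proxies add up to at most [K + d r / (n p)]. *)
Lemma trace_tail i X s (K tau theta : R) :
  mixed_off_count i X <= K -> 0 <= theta <= 2^-1 ->
  \sum_(X' | mat_agree i X X' && (tau <= trace_score s i X')) mat_weight X' <=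
  expR (- (theta * tau) + 2 * theta ^+ 2 * (K + d%:R * (r / (n%:R * p))))
  * class_weight i X.
Proof.
move=> HK th; have [th0 _] := andP th.
(* The indicator of the tail event is at most [expR (theta (score - tau))]. *)
have step : \sum_(X' | mat_agree i X X' && (tau <= trace_score s i X')) mat_weight X' <=
    expR (- (theta * tau)) * \sum_(X' | mat_agree i X X')
      \prod_j (col_weight (X' j) * expR (theta * (pm1 (s j) * col_score i (X' j)))).
  rewrite mulr_sumr big_mkcondr /=; apply: ler_sum => X' _.
  rewrite big_split /= -expR_sum -mulr_sumr -/(trace_score s i X') mulrCA -exp.expRD.
  case: ifP => ht; last by rewrite mulr_ge0 ?expR_ge0 // ltW ?mat_weight_gt0.
  rewrite ler_peMr ?(ltW (mat_weight_gt0 _)) // -[leLHS]exp.expR0 ler_expR addrC.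
  by rewrite subr_ge0 ler_wpM2l.
apply: le_trans step _; rewrite exp.expRD -mulrA ler_wpM2l ?expR_ge0 //.
rewrite -(bigA_distr_big_dep _
  (fun j c => col_weight c * expR (theta * (pm1 (s j) * col_score i c)))).
apply: (@le_trans _ _ (\prod_j (expR (2 * theta ^+ 2 * score_var i (X j)) *
     \sum_(c | agree i (X j) c) col_weight c))).
  apply: ler_prod => j _; rewrite agree_score_mgf ?pm1_sqr // andbT.
  by apply: sumr_ge0 => c _; rewrite mulr_ge0 ?expR_ge0 // ltW ?col_weight_gt0.
rewrite big_split /= -class_weight_prod -expR_sum -mulr_sumr.
rewrite ler_wpM2r ?(ltW (class_weight_gt0 _ _)) // ler_expR ler_wpM2l ?mulr_ge0 ?sqr_ge0 //.
apply: (@le_trans _ _ (\sum_j ((mixed_off i (X j))%:R + r / (n%:R * p)))).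
  apply: ler_sum => j _; rewrite /score_var.
  have rnp : 0 <= r / (n%:R * p) by rewrite divr_ge0 ?mulr_ge0 // ltW.
  by case: ifP => _ /=; [rewrite lerDl|rewrite add0r].
by rewrite big_split /= sumr_const card_ord [X in _ <= _ + X]mulr_natl lerD2r.
Qed.

Lemma sum_mat_weight : \sum_c col_weight c = 1 -> \sum_X mat_weight X = 1.
Proof.
by move=> w1; rewrite -(bigA_distr_bigA (fun (_ : 'I_d) c => col_weight c)) big1.
Qed.

Lemma expect_mixed_count : \sum_c col_weight c = 1 ->
  \sum_X mat_weight X * mixed_count X = d%:R * (r * mixed_mass R n).
Proof.
move=> w1; under eq_bigr do rewrite /mixed_count mulr_sumr.
rewrite exchange_big /= -[d in RHS]card_ord mulr_natl -sumr_const.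
apply: eq_bigr => j0 _.
rewrite -sum_mixed_weight.
(* The indicator for [j0], written as a product over all columns, lets the sum factor; every other
   column contributes [1]. *)
rewrite (eq_bigr (fun X => \prod_j (col_weight (X j) *
    (if j == j0 then (mixed (X j))%:R else 1)))); last first.
  move=> X _; rewrite big_split /=; congr (_ * _).
  by rewrite (bigD1 j0) //= eqxx big1 ?mulr1 // => j /negbTE ->.
rewrite -(bigA_distr_bigA (fun j c => col_weight c * (if j == j0 then (mixed c)%:R else 1))).
rewrite (bigD1 j0) //= eqxx [X in _ * X]big1 ?mulr1; last first.
  by move=> j /negbTE ->; under eq_bigr do rewrite mulr1.
rewrite [RHS]big_mkcond; apply: eq_bigr => c _.
by case: (mixed c); rewrite ?mulr1 ?mulr0.
Qed.

(* Markov's inequality. *)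
Lemma mixed_count_tail (K : R) : \sum_c col_weight c = 1 -> 0 < K ->
  4 * (d%:R * (r * mixed_mass R n)) <= K ->
  3 / 4 <= \sum_(X | mixed_count X <= K) mat_weight X.
Proof.
move=> w1 K0 HK.
have : \sum_(X | ~~ (mixed_count X <= K)) mat_weight X <= 4^-1.
  rewrite -(ler_pM2l K0) mulr_sumr.
  apply: (@le_trans _ _ (d%:R * (r * mixed_mass R n))); last by lra.
  rewrite -expect_mixed_count // [leRHS](bigID (fun X => mixed_count X <= K)) /=.
  rewrite ler_wpDl //.
    apply: sumr_ge0 => X _; rewrite mulr_ge0 ?(ltW (mat_weight_gt0 _)) //.
    by apply: sumr_ge0.
  apply: ler_sum => X; rewrite -ltNge => XK; rewrite mulrC.
  by rewrite ler_wpM2l ?(ltW (mat_weight_gt0 _)) // ltW.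
have := sum_mat_weight w1; rewrite (bigID (fun X => mixed_count X <= K)) /=.
by move: (\sum_(X | mixed_count X <= K) _) (\sum_(X | ~~ _) _) => a b; lra.
Qed.

(** * Tracing against a private law [Q] of the rounded output *)

Section Tracing.
Context (Q : mat -> signs -> R) (E delta : R).
Context (w1 : \sum_c col_weight c = 1) (E_ge0 : 0 <= E) (delta_ge0 : 0 <= delta).
Context (Q_ge0 : forall X s, 0 <= Q X s) (Q_sum1 : forall X, \sum_s Q X s = 1).
Context (Q_private : forall i X X' (A : pred signs), mat_agree i X X' ->
  \sum_(s | A s) Q X s <= E * \sum_(s | A s) Q X' s + delta).

(* Privacy lets the traced user's row be resampled conditionally on the other rows; by
   exchangeability the output is then independent of the row used for the score. *)
Lemma trace_prob_le i (K tau theta : R) : 0 <= theta <= 2^-1 ->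
  \sum_(X | mixed_off_count i X <= K) mat_weight X *
    (\sum_(s | tau <= trace_score s i X) Q X s) <=
  E * expR (- (theta * tau) + 2 * theta ^+ 2 * (K + d%:R * (r / (n%:R * p)))) + delta.
Proof.
move=> th; set eps := expR _.
pose g X := mixed_off_count i X <= K.
pose q X' X := \sum_(s | tau <= trace_score s i X) Q X' s.
have w_ge0 X : 0 <= mat_weight X by rewrite ltW ?mat_weight_gt0.
have u_gt0 X := class_weight_gt0 i X.
have gmass : \sum_(X | g X) mat_weight X <= 1.
  rewrite -(sum_mat_weight w1) [leRHS](bigID g) /= lerDl.
  by apply: sumr_ge0 => X _; exact: w_ge0.
(* Joint law of a matrix and a copy with row [i] resampled; it is symmetric, as [class_weight] is
   constant on classes. *)
pose k X X' := mat_weight X * mat_weight X' / class_weight i X.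
have k_ge0 X X' : 0 <= k X X' by rewrite divr_ge0 ?mulr_ge0 // ltW.
have k_sum X : \sum_(X' | mat_agree i X X') k X X' = mat_weight X.
  by rewrite /k -mulr_suml -mulr_sumr -/(class_weight i X) mulfK // gt_eqF.
have resample X : mat_weight X * q X X <=
    E * (\sum_(X' | mat_agree i X X') k X X' * q X' X) + mat_weight X * delta.
  rewrite -{1 2}k_sum !mulr_suml mulr_sumr -big_split /=.
  apply: ler_sum => X' XX'.
  have -> : E * (k X X' * q X' X) + k X X' * delta =
            k X X' * (E * q X' X + delta) by ring.
  by rewrite ler_wpM2l //; exact: (Q_private _ XX').
apply: le_trans (ler_sum _ (fun X _ => resample X)) _.
rewrite big_split /= -mulr_sumr -mulr_suml; apply: lerD; last first.
  by rewrite ler_piMl.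
rewrite ler_wpM2l // (exchange_big_dep g) /=; last first.
  by move=> X X' gX XX'; rewrite /g -(mixed_off_count_agree XX').
apply: (@le_trans _ _ (\sum_(X | g X) eps * mat_weight X)); last first.
  by rewrite -mulr_sumr ler_piMr ?expR_ge0.
apply: ler_sum => X gX.
rewrite (eq_bigl (mat_agree i X)); last first.
  move=> X'; rewrite mat_agree_sym; case: (boolP (mat_agree i X X')); rewrite ?andbF //.
  by move=> XX'; rewrite /g -(mixed_off_count_agree XX') -/(g X) gX.
(* By symmetry of [k] the roles swap: the output now comes from [X] and the score from the fresh
   copy [X'], so [trace_tail] applies to each [s]. *)
rewrite (eq_bigr (fun X' => mat_weight X / class_weight i X *
    \sum_s Q X s * (if tau <= trace_score s i X' then mat_weight X' else 0))); last first.
  move=> X' XX'; rewrite /k -(class_weight_agree XX') /q [X in _ * X = _]big_mkcond /=.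
  rewrite [_ * mat_weight X]mulrC -!mulrA; congr (_ * _); rewrite mulrCA; congr (_ * _).
  rewrite mulr_sumr; apply: eq_bigr => s _; rewrite mulrC.
  by case: ifP; rewrite ?mul0r ?mulr0.
rewrite -mulr_sumr exchange_big /=.
apply: (@le_trans _ _ (mat_weight X / class_weight i X *
   \sum_s Q X s * (eps * class_weight i X))).
  rewrite ler_wpM2l ?divr_ge0 ?(ltW (u_gt0 _)) //; apply: ler_sum => s _.
  rewrite -mulr_sumr ler_wpM2l // -big_mkcondr /=.
  exact: trace_tail.
by rewrite -mulr_suml Q_sum1 mul1r mulrCA divfK // gt_eqF.
Qed.

(** Mass at least [3 / 4] of the matrices has few mixed columns, and there somebody is traced with
    probability at least [beta]; a union bound over users then meets [trace_prob_le]. *)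
Lemma trace_all_prob_le (K tau theta beta : R) :
  0 < K -> 4 * (d%:R * (r * mixed_mass R n)) <= K -> 0 <= theta <= 2^-1 -> 0 <= beta ->
  (forall X, mixed_count X <= K ->
     beta <= \sum_(s | [exists i, tau <= trace_score s i X]) Q X s) ->
  3 / 4 * beta <= n%:R *
    (E * expR (- (theta * tau) + 2 * theta ^+ 2 * (K + d%:R * (r / (n%:R * p)))) + delta).
Proof.
move=> K0 HK th beta0 acc; set b := E * _ + _.
have w_ge0 X : 0 <= mat_weight X by rewrite ltW ?mat_weight_gt0.
apply: (@le_trans _ _ (\sum_(X | mixed_count X <= K) mat_weight X * beta)).
  by rewrite -mulr_suml ler_wpM2r // mixed_count_tail.
apply: (@le_trans _ _ (\sum_(X | mixed_count X <= K) mat_weight X *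
    \sum_i \sum_(s | tau <= trace_score s i X) Q X s)).
  apply: ler_sum => X XK; rewrite ler_wpM2l //; apply: le_trans (acc X XK) _.
  under [leRHS]eq_bigr do rewrite big_mkcond.
  rewrite exchange_big /= [leLHS]big_mkcond; apply: ler_sum => s _.
  case: ifP => [/existsP[i Hi]|_]; last by apply: sumr_ge0 => i _; case: ifP.
  rewrite (bigD1 i) //= Hi lerDl; apply: sumr_ge0 => j _; by case: ifP.
under eq_bigr do rewrite mulr_sumr.
rewrite exchange_big /= -[n in n%:R]card_ord mulr_natl -sumr_const.
apply: ler_sum => i _; apply: le_trans (trace_prob_le i K tau th).
(* The condition is relaxed to [mixed_off_count], which ignores the traced row. *)
rewrite [leLHS]big_mkcond [leRHS]big_mkcond; apply: ler_sum => X _.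
case: ifP => [XK|_]; first by rewrite (le_trans (mixed_off_count_le _ _) XK).
by case: ifP => // _; rewrite mulr_ge0 // sumr_ge0.
Qed.

End Tracing.

(** * From correct signs to a large score *)

(** The correct sign of a constant column is [X j != set0], so agreement with [X j == set0] is an
    error. *)
Definition wrong_count s X : R :=
  \sum_j (~~ mixed (X j) && (s j == (X j == finset.set0)))%:R.

(* Mixed columns contribute nothing to the total score, so it only depends on the
   signs recovered on the padding columns. *)
Lemma sum_trace_score_ge s X :
  r / p * (d%:R - mixed_count X - 2 * wrong_count s X) <= \sum_i trace_score s i X.
Proof.
rewrite /trace_score exchange_big /= -[d in d%:R]card_ord -sumr_const.
rewrite /mixed_count /wrong_count mulr_sumr -!sumrB mulr_sumr.
apply: ler_sum => j _; rewrite -mulr_sumr sum_col_score.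
have : 0 < r / p by rewrite divr_gt0.
move: (r / p) => q q0; case: (mixed (X j)) => /=.
  by rewrite mulr0 !mulr0 subr0 subrr mulr0.
by case: (X j == finset.set0); case: (s j); rewrite /= /pm1 ?mulr0n ?mulr1n; lra.
Qed.

(** Pigeonhole: some user reaches the average of the total score. *)
Lemma exists_trace_score_ge s X (K W tau : R) :
  mixed_count X <= K -> wrong_count s X <= W ->
  n%:R * tau <= r / p * (d%:R - K - 2 * W) ->
  [exists i, tau <= trace_score s i X].
Proof.
move=> XK sW ht; apply: contraT; rewrite negb_exists => /forallP H.
have : n%:R * tau <= \sum_i trace_score s i X.
  apply: le_trans ht (le_trans _ (sum_trace_score_ge s X)).
  by rewrite ler_wpM2l ?divr_ge0 ?(ltW r_gt0) ?(ltW p_gt0) //; lra.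
rewrite leNgt; apply: contraNT => _; rewrite -[n in ltRHS]card_ord mulr_natl -sumr_const.
apply: ltr_sum => [|i _]; last by rewrite ltNge H.
by apply/hasP; exists (Ordinal n_gt0) => //; rewrite mem_index_enum.
Qed.

End Matrices.

End Columns.

(** * Rounding to signs, and measurability *)

Section Rounding.
Context {d : nat}.
Local Open Scope classical_set_scope.

Definition sign_pattern (y : borelRd d) : {ffun 'I_d -> bool} :=
  [ffun j => 0 <= (y : 'rV[R]_d) ord0 j].

Lemma borelRd_open (U : set 'rV[R]_d) :
  open U -> measurable (U : set (borelRd d)).
Proof. by move=> oU; apply: sub_sigma_algebra. Qed.

Lemma borelRd_closed (U : set 'rV[R]_d) :
  closed U -> measurable (U : set (borelRd d)).
Proof.
move=> cU; rewrite -[U]setCK; apply: measurableC.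
by apply: borelRd_open; rewrite openC.
Qed.

Lemma measurable_sign_cell s : measurable (sign_pattern @^-1` [set s]).
Proof.
have -> : sign_pattern @^-1` [set s] =
    \big[setI/setT]_(j < d) [set y : borelRd d | (0 <= (y : 'rV[R]_d) ord0 j) = s j].
  rewrite -bigcap_seq; apply/seteqP; split => y /=.
    by move=> <- j _ /=; rewrite ffunE.
  by move=> H; apply/ffunP => j; rewrite ffunE; apply: H; rewrite /= mem_index_enum.
apply: bigsetI_measurable => j _.
have mj : measurable [set y : borelRd d | 0 <= (y : 'rV[R]_d) ord0 j].
  apply: borelRd_closed.
  apply: (@preimage_closed _ _ (fun y : 'rV[R]_d => y ord0 j) [set x | 0 <= x]).
    by move=> x _; exact: coord_continuous.
  exact: closed_ge.
case: (s j); first exact: mj.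
rewrite (_ : [set y | _] = ~` [set y : borelRd d | 0 <= (y : 'rV[R]_d) ord0 j]).
  exact: measurableC.
by apply/seteqP; split => y /=; case: (0 <= _).
Qed.

Lemma measurable_sign (A : pred {ffun 'I_d -> bool}) :
  measurable [set y : borelRd d | A (sign_pattern y)].
Proof.
have -> : [set y : borelRd d | A (sign_pattern y)] =
    \big[setU/set0]_(s | A s) (sign_pattern @^-1` [set s]).
  apply/seteqP; split => y /=.
    move=> Ay; rewrite -bigcup_seq_cond; exists (sign_pattern y) => //=.
    by rewrite mem_index_enum.
  by rewrite -bigcup_seq_cond => -[s /=] /andP[_ As] ->.
by apply: bigsetU_measurable => s _; exact: measurable_sign_cell.
Qed.

Definition sign_prob (P : probability (borelRd d) R) s : R :=
  fine (P (sign_pattern @^-1` [set s])).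

Lemma sum_sign_prob (P : probability (borelRd d) R) (A : pred {ffun 'I_d -> bool}) :
  \sum_(s | A s) sign_prob P s = fine (P [set y | A (sign_pattern y)]).
Proof.
(* Generalised to duplicate-free lists, so that finite additivity follows by induction. *)
suff H (l : seq {ffun 'I_d -> bool}) : uniq l -> \sum_(s <- l | A s) sign_prob P s =
    fine (P [set y | A (sign_pattern y) && (sign_pattern y \in l)]).
  rewrite H ?index_enum_uniq //; congr (fine (P _)).
  by apply/seteqP; split => y /=; rewrite mem_index_enum andbT.
elim: l => [|s l IH] /=.
  move=> _; rewrite big_nil (_ : [set _ | _] = set0) ?measure0 //.
  by apply/seteqP; split => y //=; rewrite andbF.
move=> /andP[sl /IH {}IH]; rewrite big_cons IH.
have -> : [set y | A (sign_pattern y) && (sign_pattern y \in s :: l)] =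
   [set y | A (sign_pattern y) && (sign_pattern y \in l)] `|`
   (if A s then sign_pattern @^-1` [set s] else set0).
  apply/seteqP; split => y /=; rewrite inE.
    case/andP => Ay /orP[/eqP yE|yl]; last by left; rewrite Ay.
    by right; rewrite -yE Ay.
  case=> [/andP[-> ->]|]; first by rewrite orbT.
  by case: ifP => // As /= ->; rewrite As eqxx.
case: ifP => As; last by rewrite setU0.
have ml := measurable_sign (fun s' => A s' && (s' \in l)).
have ms := measurable_sign_cell s.
rewrite measureU //.
  by rewrite fineD ?(fin_num_measure P) // addrC.
by apply/seteqP; split => y //= [/andP[_ yl]] ys; rewrite -ys yl in sl.
Qed.

End Rounding.

(** * Hypercube datasets from bit matrices *)

Section Datasets.
Context {n d : nat}.
Context (n_gt0 : (0 < n)%N).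
Local Open Scope classical_set_scope.
Implicit Types (X : {ffun 'I_d -> {set 'I_n}}).

Definition mat_dataset X : dataset n d := fun i => \row_j pm1 (i \in X j).

Lemma mat_dataset_hypercube X : in_hypercube (mat_dataset X).
Proof. by move=> i j; rewrite mxE; case: (i \in X j); [left|right]. Qed.

Lemma l2norm_sqr (v : 'rV[R]_d) : l2norm v ^+ 2 = \sum_j v ord0 j ^+ 2.
Proof. by rewrite sqr_sqrtr // sumr_ge0 // => j _; rewrite sqr_ge0. Qed.

(** Two rows differ only on mixed columns, by at most [2] in each. *)
Lemma mat_dataset_diameter X (K : R) i i' : mixed_count X <= K ->
  l2norm (mat_dataset X i - mat_dataset X i') <= Num.sqrt (4 * K).
Proof.
move=> XK; apply: ler_wsqrtr; apply: (@le_trans _ _ (4 * mixed_count X)); last first.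
  by rewrite ler_wpM2l.
rewrite mulr_sumr; apply: ler_sum => j _; rewrite !mxE.
have [_|] := boolP (mixed (X j)).
  by case: (i \in X j); case: (i' \in X j); rewrite /pm1 mulr1n; lra.
by rewrite mixedPn => /orP[/eqP->|/eqP->]; rewrite !inE subrr expr0n mulr0.
Qed.

Lemma average_pad X j : ~~ mixed (X j) ->
  average (mat_dataset X) ord0 j = pm1 (X j != finset.set0).
Proof.
have n0 : n%:R != 0 :> R by rewrite pnatr_eq0 -lt0n.
rewrite mixedPn => Xj; rewrite /average mxE summxE.
rewrite (eq_bigr (fun=> pm1 (X j != finset.set0))); last first.
  move=> i _; rewrite mxE; case/orP: Xj => /eqP ->; first by rewrite eqxx !inE.
  rewrite !inE (_ : finset.setT != finset.set0) //.
  by apply/finset.set0Pn; exists i; rewrite inE.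
by rewrite sumr_const card_ord -[pm1 _ *+ n]mulr_natl mulrA mulVf // mul1r.
Qed.

(** A wrong sign on a constant column puts that coordinate at distance at least [1] from the
    average, which is [1] or [-1] there. *)
Lemma wrong_count_le X (y : borelRd d) :
  wrong_count (sign_pattern y) X <= l2norm ((y : 'rV[R]_d) - average (mat_dataset X)) ^+ 2.
Proof.
rewrite l2norm_sqr; apply: ler_sum => j _.
have [/andP[mj sj]|_] := boolP (_ && _); last first.
  by rewrite mulr0n sqr_ge0.
rewrite mxE [X in _ + X]mxE average_pad // mulr1n.
move: sj; rewrite ffunE; case: (X j == finset.set0) => /eqP sj /=; rewrite /pm1.
  by rewrite opprK -[leLHS](expr1n _ 2) lerXn2r ?nnegrE //; lra.
have : (y : 'rV[R]_d) ord0 j < 0 by rewrite ltNge sj.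
by move=> yj; rewrite -sqrrN -[leLHS](expr1n _ 2) lerXn2r ?nnegrE //; lra.
Qed.

Lemma measurable_l2ball (a : 'rV[R]_d) (e : R) :
  measurable [set y : borelRd d | l2norm ((y : 'rV[R]_d) - a) <= e].
Proof.
pose f (y : 'rV[R]_d) : R := Num.sqrt (\sum_j (y ord0 j - a ord0 j) ^+ 2).
rewrite (_ : [set y | _] = f @^-1` [set x | x <= e]); last first.
  have fE y : l2norm (y - a) = f y.
    by congr (Num.sqrt _); apply: eq_bigr => j _; rewrite !mxE.
  by apply/seteqP; split => y /=; rewrite fE.
apply: borelRd_closed; apply: preimage_closed; last exact: closed_le.
move=> x _; apply: continuous_comp; last exact: sqrt_continuous.
apply: continuous_big => [|j _ {}x].
  exact: (@pseudometric_normed_Zmodule.add_continuous R R^o).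
apply: (@continuous_comp _ _ _ (fun y : 'rV[R]_d => y ord0 j - a ord0 j) (fun t => t ^+ 2)).
  exact: (@continuousB R R^o 'rV[R]_d (fun y => y ord0 j) (fun=> a ord0 j) x
    (@coord_continuous R 1 d ord0 j x) (@cst_continuous _ _ (a ord0 j) x)).
exact: exprn_continuous.
Qed.

(** [neighbors] demands distinct rows at [i], so a row resampled to itself is a separate case. *)
Lemma mat_dataset_agree i X X' : mat_agree i X X' ->
  mat_dataset X = mat_dataset X' \/ neighbors (mat_dataset X) (mat_dataset X').
Proof.
move=> /mat_agreeP H.
have off k : k <> i -> mat_dataset X k = mat_dataset X' k.
  move=> /eqP ki; apply/rowP => j; rewrite !mxE.
  by have := congr1 (fun c : {set 'I_n} => k \in c) (H j); rewrite !inE ki /= => ->.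
have [e|e] := eqVneq (mat_dataset X i) (mat_dataset X' i).
  by left; apply/funext => k; have [->//|/eqP/off] := eqVneq k i.
by right; exists i; split; [exact/eqP|].
Qed.

End Datasets.

(** * Choice of the parameters *)

Section Numerics.
Context {R : realType}.
Implicit Types N D lambda h K r tau theta p beta L : R.

(** The variance term is at most [2 K], and [theta = tau / (8 K)] minimises
    [4 theta^2 K - theta tau], with value [- theta tau / 2]. *)
Lemma trace_exponent_le N D lambda h p r K tau theta :
  1 <= N -> 0 < D -> 1 <= lambda -> 1 <= h -> 4^-1 <= p ->
  r = (72 * lambda ^+ 2 * h)^-1 -> K = 4 * (r * h * D) -> tau = r * D / N ->
  theta = (32 * N * h)^-1 ->
  - (theta * tau) + 2 * theta ^+ 2 * (K + D * (r / (N * p))) <=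
  - (D / ((72 * 64) * N ^+ 2 * lambda ^+ 2 * h ^+ 2)).
Proof.
move=> N1 D0 l1 h1 p4 rE KE tauE thetaE.
have [N0 l0 h0 p0] : [/\ 0 < N, 0 < lambda, 0 < h & 0 < p] by split; lra.
have r0 : 0 < r by rewrite rE invr_gt0 !mulr_gt0 ?exprn_gt0.
have dK : D * (r / (N * p)) <= K.
  rewrite mulrA ler_pdivrMr ?mulr_gt0 // KE.
  have -> : 4 * (r * h * D) * (N * p) = (D * r) * (h * N * (4 * p)) by ring.
  rewrite ler_peMr ?mulr_ge0 ?(ltW D0) ?(ltW r0) //.
  by apply: mulr_ege1; [exact: mulr_ege1|lra].
apply: (@le_trans _ _ (- (theta * tau) + 2 * theta ^+ 2 * (K + K))).
  rewrite lerD2l; apply: ler_wpM2l; last by rewrite lerD2l.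
  by rewrite pmulr_rge0 // sqr_ge0.
rewrite le_eqVlt; apply/orP; left; apply/eqP; rewrite KE tauE thetaE rE.
by field; rewrite !gt_eqF.
Qed.

(** The [72] in [r] makes [lambda^2 K = D / 18], so mixed and wrong columns cost at most
    [9 lambda^2 K = D / 2]; [p <= 1/2] makes up for this half. *)
Lemma trace_threshold_le N D lambda h p r K tau :
  1 <= N -> 0 < D -> 1 <= lambda -> 1 <= h -> 0 < p -> p <= 2^-1 ->
  r = (72 * lambda ^+ 2 * h)^-1 -> K = 4 * (r * h * D) -> tau = r * D / N ->
  N * tau <= r / p * (D - K - 2 * (lambda ^+ 2 * (4 * K))).
Proof.
move=> N1 D0 l1 h1 p0 p2 rE KE tauE.
have [N0 l0 h0] : [/\ 0 < N, 0 < lambda & 0 < h] by split; lra.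
have r0 : 0 < r by rewrite rE invr_gt0 !mulr_gt0 ?exprn_gt0.
have -> : N * tau = r * D by rewrite tauE mulrC divfK // gt_eqF.
have lKE : lambda ^+ 2 * K = D / 18.
  by rewrite KE rE; field; rewrite !gt_eqF.
have lK : K <= lambda ^+ 2 * K.
  apply: ler_peMl; first by rewrite KE !mulr_ge0 // ltW.
  by apply: exprn_ege1.
apply: (@le_trans _ _ (r / p * (D / 2))); last first.
  rewrite ler_wpM2l ?divr_ge0 ?(ltW r0) ?(ltW p0) //.
  have -> : lambda ^+ 2 * (4 * K) = 4 * (lambda ^+ 2 * K) by ring.
  by lra.
have -> : r / p * (D / 2) = r * D * (2 * p)^-1 by field; rewrite gt_eqF.
apply: ler_peMr; first by rewrite mulr_ge0 // ltW.
by rewrite invf_ge1 ?mulr_gt0 //; lra.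
Qed.

(** The [delta] term contributes [beta / 4]. The other stays below [beta / 2] because [N / beta],
    [expR 1] and [2] are each at most [expR L], while the exponent exceeds [3 L]. *)
Lemma trace_contradiction N D lambda beta L :
  1 <= N -> 0 < beta -> 1 <= lambda -> 1 <= L -> N / beta <= expR L ->
  600 ^+ 2 * (N ^+ 2 * lambda ^+ 2 * L ^+ 3) < D ->
  N * (expR 1 * expR (- (D / ((72 * 64) * N ^+ 2 * lambda ^+ 2 * (4 * L) ^+ 2)))
       + beta / (4 * N)) < 3 / 4 * beta.
Proof.
move=> N1 b0 l1 L1 NL HD.
have [N0 l0 L0] : [/\ 0 < N, 0 < lambda & 0 < L] by split; lra.
have q0 : 0 < N ^+ 2 * lambda ^+ 2 * L ^+ 2 by rewrite !mulr_gt0 ?exprn_gt0.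
set x := D / _.
have x3 : 3 * L < x.
  rewrite /x ltr_pdivlMr; last by rewrite !mulr_gt0 ?exprn_gt0 // mulr_gt0.
  apply: le_lt_trans HD.
  (* Here [3 * 72 * 64 * 4^2 = 221184] must not exceed [600^2]. *)
  have -> : 3 * L * ((72 * 64) * N ^+ 2 * lambda ^+ 2 * (4 * L) ^+ 2) =
    3 * (72 * 64) * 4 ^+ 2 * (N ^+ 2 * lambda ^+ 2 * L ^+ 3) by ring.
  by rewrite ler_wpM2r ?mulr_ge0 ?exprn_ge0 ?(ltW N0) ?(ltW l0) ?(ltW L0) //; lra.
have -> : N * (expR 1 * expR (- x) + beta / (4 * N)) =
   beta * (N / beta * expR 1 * expR (- x)) + beta / 4.
  by field; rewrite !gt_eqF.
have e2 : 2 <= expR L by rewrite (le_trans _ (expR_ge1Dx L)) //; lra.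
have e1 : expR 1 <= expR L by rewrite ler_expR.
have : N / beta * expR 1 * expR (- x) < 2^-1.
  rewrite exp.expRN ltr_pdivrMr ?expR_gt0 // [ltRHS]mulrC ltr_pdivlMr //.
  apply: (@le_lt_trans _ _ (expR L * expR L * expR L)).
    apply: ler_pM => //; first by rewrite !mulr_ge0 ?invr_ge0 ?expR_ge0 // ltW.
    by apply: ler_pM => //; rewrite ?divr_ge0 ?expR_ge0 // ltW.
  by rewrite -!exp.expRD ltr_expR; lra.
by move=> H; have := H; rewrite -(ltr_pM2l b0); lra.
Qed.

End Numerics.

(** * Assembling the lower bound *)

Lemma private_estimator_bound n d (lambda beta h : R) (M : R -> mechanism n d) :
  (0 < n)%N -> (0 < d)%N -> 1 <= lambda -> 0 < beta ->
  1 <= h -> mixed_mass R n <= h ->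
  averaging_estimator lambda beta M ->
  (forall gamma : R, 0 <= gamma ->
     diff_private 1%R (beta / (4 * n%:R))%R (M gamma)) ->
  3 / 4 * beta <= n%:R * (expR 1 *
     expR (- (d%:R / ((72 * 64) * n%:R ^+ 2 * lambda ^+ 2 * h ^+ 2)))
     + beta / (4 * n%:R)).
Proof.
move=> n0 d0 l1 b0 h1 Zh acc dp.
have N1 : 1 <= n%:R :> R by rewrite ler1n.
have D0 : 0 < d%:R :> R by rewrite ltr0n.
have lam0 : 0 < lambda by lra.
have l2 : 1 <= lambda ^+ 2 by exact: exprn_ege1.
have [l0 h0] : 0 < lambda ^+ 2 /\ 0 < h by split; lra.
pose r := (72 * lambda ^+ 2 * h)^-1.
have lh1 : 1 <= lambda ^+ 2 * h by exact: mulr_ege1.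
have r0 : 0 < r by rewrite invr_gt0 !mulr_gt0.
have rh : r * h <= 72^-1.
  have -> : r * h = 72^-1 * (lambda ^+ 2)^-1 by rewrite /r; field; rewrite !gt_eqF.
  by rewrite ler_piMr // invf_le1.
have r72 : r <= 72^-1 by rewrite (le_trans _ rh) // ler_peMr // ltW.
pose Z := mixed_mass R n; have Z0 : 0 <= Z := mixed_mass_ge0 n.
have rZ : r * Z <= r * h by rewrite ler_wpM2l // ltW.
have rZ0 : 0 <= r * Z by rewrite mulr_ge0 // ltW.
(* The mass left by the mixed columns, split between the two constant ones. *)
pose p := (1 - r * Z) / 2.
have [p4 p2] : 4^-1 <= p /\ p <= 2^-1 by rewrite /p; split; lra.
have p0 : 0 < p by lra.
have rp : r <= p by lra.
(* [K] is four times a bound on the expected number of mixed columns, as Markov's inequality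
   requires. *)
pose K := 4 * (r * h * d%:R); pose tau := r * d%:R / n%:R.
pose theta := (32 * n%:R * h)^-1.
have K0 : 0 < K by rewrite !mulr_gt0.
have th : 0 <= theta <= 2^-1.
  have nh : 1 <= n%:R * h by exact: mulr_ege1.
  rewrite invr_ge0 !mulr_ge0 ?(ltW h0) //= lef_pV2 ?posrE ?mulr_gt0 //; last by lra.
  by rewrite -mulrA; lra.
pose gamma := Num.sqrt (4 * K).
have gamma0 : 0 <= gamma by rewrite sqrtr_ge0.
pose Q (X : {ffun 'I_d -> {set 'I_n}}) := sign_prob (M gamma (mat_dataset X)).
have w1 : \sum_(c : {set 'I_n}) col_weight r p c = 1.
  by apply: sum_col_weight => //; rewrite /p -/Z; field.
have delta0 : 0 <= beta / (4 * n%:R) by rewrite divr_ge0 // ltW.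
have Q_ge0 X s : 0 <= Q X s by apply: fine_ge0.
have Q_sum1 X : \sum_s Q X s = 1.
  rewrite (sum_sign_prob _ xpredT) (_ : [set _ | _]%classic = setT) ?probability_setT //.
  by apply/seteqP; split.
have finM X B : measurable B -> M gamma (mat_dataset X) B \is a fin_num.
  by move=> mB; exact: fin_num_measure.
have Q_private i X X' (A : pred {ffun 'I_d -> bool}) : mat_agree i X X' ->
    \sum_(s | A s) Q X s <= expR 1 * \sum_(s | A s) Q X' s + beta / (4 * n%:R).
  move=> XX'; rewrite !sum_sign_prob; have mA := measurable_sign A.
  have [->|nb] := mat_dataset_agree XX'.
    rewrite ler_wpDr // ler_peMl ?fine_ge0 //.
    by rewrite (le_trans _ (expR_ge1Dx _)) //; lra.
  have := dp gamma gamma0 _ _ nb _ mA.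
  rewrite -{1}(fineK (finM X _ mA)) -{1}(fineK (finM X' _ mA)).
  by rewrite -EFinM -EFinD lee_fin.
have traced X : mixed_count X <= K ->
    beta <= \sum_(s | [exists i, tau <= trace_score r p s i X]) Q X s.
  move=> XK; have mT := measurable_sign (fun s => [exists i, tau <= trace_score r p s i X]).
  rewrite sum_sign_prob -lee_fin (fineK (finM X _ mT)).
  apply: le_trans (acc gamma _ gamma0 (mat_dataset_hypercube X) _) _.
    by move=> i i'; exact: mat_dataset_diameter.
  have mB := measurable_l2ball (average (mat_dataset X)) (lambda * gamma)%R.
  (* The inequality in [averaging_estimator] is parsed in Stdlib's real number scope. *)
  have -> : [set y | Rle (l2norm (y - average (mat_dataset X)))
                         (Rmult lambda gamma)]%classic =
      [set y : borelRd d | l2norm ((y : 'rV[R]_d) - average (mat_dataset X)) <=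
         (lambda * gamma)%R]%classic.
    by apply/seteqP; split => y /=; rewrite RmultE => /RleP.
  apply: le_measure (mem_set mB) (mem_set mT) _ => y /= ball.
  (* A point of the ball has at most [(lambda gamma)^2 = 4 lambda^2 K] wrong signs. *)
  apply: (exists_trace_score_ge n0 r0 p0 XK (W := lambda ^+ 2 * (4 * K))).
    apply: le_trans (wrong_count_le n0 X y) _.
    have -> : lambda ^+ 2 * (4 * K) = (lambda * gamma) ^+ 2.
      by rewrite exprMn sqr_sqrtr // mulr_ge0 // ltW.
    have lg : 0 <= lambda * gamma by rewrite mulr_ge0 //; lra.
    by rewrite lerXn2r ?nnegrE // sqrtr_ge0.
  exact: (trace_threshold_le (h := h)).
apply: le_trans (trace_all_prob_le n0 r0 p0 rp w1 (expR_ge0 1) delta0 Q_ge0 Q_sum1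
  Q_private K0 _ th (ltW b0) traced) _.
  by rewrite /K ler_wpM2l // mulrC ler_wpM2r.
rewrite ler_wpM2l // lerD2r ler_wpM2l ?expR_ge0 // ler_expR.
exact: (trace_exponent_le (h := h)).
Qed.

Theorem theorem1p9 :
  exists c : R, 0 < c /\
  forall (n d : nat) (lambda beta : R) (M : R -> mechanism n d),
    (0 < n)%nat -> 1 <= lambda -> 0 < beta -> beta <= 1 ->
    averaging_estimator lambda beta M ->
    (forall gamma : R, 0 <= gamma ->
       diff_private 1 (beta / (4 * n%:R)) (M gamma)) ->
    c * (Num.sqrt (d%:R) / lambda)
      / (Num.max 1 (ln (d%:R / (beta * lambda)))) `^ (3 / 2) <= n%:R.
Proof.
exists 600^-1; split => [|n d lambda beta M n0 l1 b0 b1 acc dp]; first by rewrite invr_gt0.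
have N1 : 1 <= n%:R :> R by rewrite ler1n.
have [->|] := posnP d; first by rewrite sqrtr0 mul0r mulr0 mul0r.
move=> d0; set L := Num.max _ _.
have L1 : 1 <= L by rewrite le_max lexx.
have [N0 l0 L0] : [/\ 0 < n%:R :> R, 0 < lambda & 0 < L] by split; lra.
have P0 : 0 < L `^ (3 / 2) by rewrite powR_gt0.
have P1 : 1 <= L `^ (3 / 2).
  by rewrite -[leLHS](powRr0 L) ler_powR //; lra.
rewrite leNgt; apply/negP.
rewrite ltr_pdivlMr // mulrA ltr_pdivlMr // ltr_pdivlMl // => H.
have D1 : 1 <= d%:R :> R by rewrite ler1n.
have D0 : 0 < d%:R :> R by lra.
have sqrt_sqr : Num.sqrt d%:R ^+ 2 = d%:R :> R by rewrite sqr_sqrtr // ltW.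
(* The negated bound, squared. In [L^3], two factors pay for [h^2] with [h = 4 L] and one for the
   exponent [3 L]; hence the power [3/2]. *)
have HD : 600 ^+ 2 * (n%:R ^+ 2 * lambda ^+ 2 * L ^+ 3) < d%:R :> R.
  have -> : L ^+ 3 = (L `^ (3 / 2)) ^+ 2.
    rewrite -powR_mulrn ?powR_ge0 // -powRrM -powR_mulrn ?(ltW L0) //.
    by congr (_ `^ _); field.
  have -> : 600 ^+ 2 * (n%:R ^+ 2 * lambda ^+ 2 * (L `^ (3 / 2)) ^+ 2) =
      (600 * (n%:R * L `^ (3 / 2) * lambda)) ^+ 2 :> R by ring.
  have H0 : 0 <= 600 * (n%:R * L `^ (3 / 2) * lambda) by rewrite !mulr_ge0 // ltW.
  by rewrite -[ltRHS]sqrt_sqr ltr_pXn2r // ?nnegrE // sqrtr_ge0.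
(* The negated bound also gives [n lambda <= d], which replaces [n / beta] by the
   [d / (beta lambda)] inside the logarithm. *)
have nl_le_d : n%:R * lambda <= d%:R :> R.
  have s1 : 1 <= Num.sqrt d%:R :> R by rewrite -[leLHS]sqrtr1 ler_wsqrtr.
  apply: (@le_trans _ _ (Num.sqrt d%:R)); last first.
    by rewrite -[leRHS]sqrt_sqr expr2 ler_peMr //; lra.
  apply: le_trans (ltW H).
  have -> : 600 * (n%:R * L `^ (3 / 2) * lambda) =
      n%:R * lambda * (600 * L `^ (3 / 2)) by ring.
  by rewrite ler_peMr ?mulr_ge0 ?(ltW N0) ?(ltW l0) //; lra.
have NL : n%:R / beta <= expR L.
  apply: (@le_trans _ _ (d%:R / (beta * lambda))).
    by rewrite ler_pdivlMr ?mulr_gt0 // mulrA divfK ?gt_eqF.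
  rewrite -[leLHS]lnK ?posrE ?divr_gt0 ?mulr_gt0 // ler_expR.
  by rewrite le_max lexx orbT.
have lnL : ln n%:R <= L.
  rewrite -ler_expR lnK ?posrE //; apply: le_trans NL.
  by rewrite ler_peMr ?(ltW N0) // invf_ge1.
(* [2 (1 + ln n) <= 2 (1 + L) <= 4 L]. *)
have Zh : mixed_mass R n <= 4 * L by apply: le_trans (mixed_mass_le n0) _; lra.
have {}dp gamma : 0 <= gamma -> diff_private 1%R (beta / (4 * n%:R))%R (M gamma).
  move=> /dp; rewrite RdivE RmultE (_ : IZR 4 = 4%:R) //.
  by rewrite IZRposE INRE.
have h1 : 1 <= 4 * L by lra.
have := private_estimator_bound n0 d0 l1 b0 h1 Zh acc dp.
by rewrite leNgt trace_contradiction.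
Qed.
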